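(* Let $a,b$ be positive integers, and let $(f[n])_{n\ge 1}$ be defined by $f[1]=f[2]=1$ and $f[n]=a f[n-1]+b f[n-2]$ for $n\ge 3$. For each positive integer $N$ let $\bar{X}=\bar{X}_N$ be a random variable with values in $\{1,\dots,N\}$ and $P(\bar{X}_N=n)=\dfrac{f[n]}{\sum_{k=1}^{N}f[k]}$ for $1\le n\le N$. Then $$\lim_{N\to\infty}E(\bar{X}_N)=\infty .$$
   Context: $E$ denotes expectation. *)

(* Defs.v *)
From HB Require Import structures.
From mathcomp Require Export all_boot all_order all_algebra.
From mathcomp Require Export all_classical all_reals all_analysis.

Set Implicit Arguments.
Unset Strict Implicit.
Unset Printing Implicit Defensive.

Export Order.TTheory GRing.Theory Num.Theory.
Export numFieldNormedType.Exports.

(* Main.v *)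
(** The weights [f n] are positive and nondecreasing, so the values [n > N/2]
    carry at least half of the mass of [X N], and Markov's inequality bounds the
    expectation below by about [N/4]. *)
Require Import Defs.
From mathcomp Require Import lra.

Local Open Scope classical_set_scope.
Local Open Scope ring_scope.
Local Open Scope ereal_scope.

(** Since [a >= 1], the recurrence gives [f n >= f (n - 1)] from [n = 3] on, and [f 1 = f 2]; [f 0]
    is unconstrained, hence the shift to [n.+1]. The cutoff [m] depends only on the target bound
    [A]: for every [N >= 2m] the values above [m] have probability at least 1/2, so the expectation
    is at least [(m + 1) / 2]. *)

Lemma linear_recurrence_nondecreasing (a b : nat) (f : nat -> nat) :
  (0 < a)%N -> f 1%N = 1%N -> f 2%N = 1%N ->
  (forall n : nat, (3 <= n)%N ->
    f n = (a * f (n - 1) + b * f (n - 2))%N) ->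
  {homo (fun n => f n.+1) : m n / (m <= n)%N}.
Proof.
move=> a0 f1 f2 frec; apply: homo_leq => [n||[|n]]; first exact: leqnn.
- exact: leq_trans.
- by rewrite f1 f2.
- rewrite (frec n.+3)// subn1 /= (leq_trans (leq_pmull _ a0))//.
  exact: leq_addr.
Qed.

(** Shifting by [m] sends the block [1..m] onto [m+1..2m], which lies in the tail and dominates it
    termwise. *)
Lemma sum_le_upper_half (f : nat -> nat) (m N : nat) :
  {homo (fun n => f n.+1) : i j / (i <= j)%N} -> (m.*2 <= N)%N ->
  (\sum_(1 <= k < N.+1) f k <= 2 * \sum_(m.+1 <= k < N.+1) f k)%N.
Proof.
move=> fhomo mN.
have mleN : (m <= N)%N by rewrite (leq_trans _ mN)// -addnn leq_addr.
rewrite (@big_cat_nat _ _ _ m.+1)//= mul2n -addnn leq_add2r.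
rewrite !big_add1/=.
rewrite [leqRHS](@big_cat_nat _ _ _ m.*2)//=; last by rewrite -addnn leq_addr.
rewrite (leq_trans _ (leq_addr _ _))// -{2}[m]add0n big_addn -addnn addnK.
by apply: leq_sum => i _; apply: fhomo; exact: leq_addr.
Qed.

(** The events [X = n] are disjoint and each lies in the tail event, which is written with an
    absolute value to fit Markov's inequality. *)
Lemma sum_pmf_le_tail (d : measure_display) (T : measurableType d)
    (R : realType) (P : probability T R) (X : {RV P >-> R}) (m N : nat) :
  \sum_(m <= n < N) P [set t | X t = n%:R%R] <=
  P [set t | m%:R%:E <= `|(X t)%:E|].
Proof.
pose F n := [set t | X t = (n + m)%:R%R].
have mF n : measurable (F n).
  by rewrite -[F n]setTI; exact: measurable_funP1.
have tF : trivIset setT F.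
  move=> i j _ _ [t [/= ti tj]]; apply/eqP.
  by rewrite -(eqn_add2r m) -(eqr_nat R) -ti -tj.
rewrite -{1}[m]add0n big_addn big_mkord -[leLHS](measure_bigsetU P mF tF).
apply: le_measure; rewrite ?inE.
- exact: bigsetU_measurable.
- rewrite -[X in measurable X]setTI.
  apply: (measurable_fun_le measurableT (measurable_cst _)).
  exact: measurableT_comp.
- rewrite -bigcup_mkord => t [n _ /= ->].
  by rewrite lee_fin ger0_norm// ler_nat leq_addl.
Qed.

Lemma expectation_ge_sum_pmf (d : measure_display) (T : measurableType d)
    (R : realType) (P : probability T R) (X : {RV P >-> R}) (m N : nat) :
  (forall t, 0 <= X t)%R ->
  m%:R%:E * \sum_(m <= n < N) P [set t | X t = n%:R%R] <= 'E_P[X].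
Proof.
move=> X0; have [->|m0] := posnP m.
  by rewrite mul0e expectation_ge0.
rewrite (le_trans (lee_wpmul2l _ (sum_pmf_le_tail _ _ _ _ X m N))) ?lee_fin//.
(* Markov's inequality bounds the expectation of a function of [|X|]; here that function is the
   identity and [X] is nonnegative. *)
rewrite -[in leRHS](_ : idfun \o Num.norm \o X = X); last first.
  by apply/funext => t /=; rewrite ger0_norm.
have m0R : (0 < m%:R :> R)%R by rewrite ltr0n.
by apply: (@markov _ _ _ P X idfun _ m0R) => //; exact: measurable_id.
Qed.

Theorem theorem4p1 (R : realType) (a b : nat)
  (ha : (0 < a)%N) (hb : (0 < b)%N)
  (f : nat -> nat)
  (hf1 : f 1%N = 1%N) (hf2 : f 2%N = 1%N)
  (hf : forall n : nat, (3 <= n)%N ->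
    f n = (a * f (n - 1) + b * f (n - 2))%N)
  (d : nat -> measure_display)
  (T : forall N : nat, measurableType (d N))
  (P : forall N : nat, probability (T N) R)
  (X : forall N : nat, {RV (P N) >-> R})
  (hXval : forall N : nat, (0 < N)%N -> forall t : T N,
    exists2 n : nat, (1 <= n <= N)%N & X N t = n%:R%R)
  (hXlaw : forall N n : nat, (1 <= n <= N)%N ->
    P N [set t : T N | X N t = n%:R%R] =
      ((f n)%:R / \sum_(1 <= k < N.+1) (f k)%:R)%R%:E) :
  'E_(P N)[X N] @[N --> \oo] --> +oo.
Proof.
have fhomo := linear_recurrence_nondecreasing a b f ha hf1 hf2 hf.
(* The factor 2 makes up for the half of the mass lost below the cutoff: [m + 1 > 2A], also when [A]
   is negative and [m = 0]. *)
apply/cvgeyPge => A; pose m := Num.truncn (2 * A)%R.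
near=> N.
have mN : (m.*2 <= N)%N by near: N; exact: nbhs_infty_ge.
have N0 : (0 < N)%N by near: N; exact: nbhs_infty_gt.
have S0 : (0 < \sum_(1 <= k < N.+1) f k)%N.
  by rewrite big_nat_recl// hf1.
have X0 t : (0 <= X N t)%R by have [n _ ->] := hXval N N0 t.
apply: le_trans (expectation_ge_sum_pmf _ _ _ _ _ m.+1 N.+1 X0).
rewrite (eq_big_nat _ _ (F2 := fun n =>
    ((f n)%:R / \sum_(1 <= k < N.+1) (f k)%:R)%R%:E)); last first.
  move=> n /andP[mn nN]; apply: hXlaw.
  by rewrite (leq_trans _ mn).
rewrite sumEFin -EFinM lee_fin -mulr_suml -!natr_sum.
rewrite mulrA ler_pdivlMr ?ltr0n//.
set S := (\sum_(1 <= k < N.+1) f k)%N in S0 *.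
set U := (\sum_(m.+1 <= k < N.+1) f k)%N.
have SU : (S%:R <= 2 * U%:R :> R)%R.
  by rewrite -natrM ler_nat; exact: sum_le_upper_half.
have Am : (2 * A <= m.+1%:R)%R by apply/ltW; exact: truncnS_gt.
(* Chain [2 A S <= (m + 1) S <= 2 (m + 1) U]; the products are supplied explicitly so that what
   remains is linear. *)
have := ler_wpM2r (ler0n R S) Am.
have := ler_wpM2l (ler0n R m.+1) SU.
lra.
Unshelve. all: by end_near.
Qed.
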